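(* Let $t\geq 2$ be an integer and let $P$ be a sunflower $t$-pattern. Then $f_t(n,P)=O(n^{t-1})$; that is, there is a constant $a_P$ depending only on $P$ such that $f_t(n,P)\leq a_P\,n^{t-1}$ for all positive integers $n$.
   Context: A $t$-dimensional matrix of size $n_1\times\dots\times n_t$ has entries $M_{i_1,\dots,i_t}$ with $1\le i_r\le n_r$. A submatrix of $M$ of size $m_1\times\dots\times m_t$ is obtained by choosing, for each coordinate $r$, indices $1\le \sigma_r(1)<\dots<\sigma_r(m_r)\le n_r$ and taking $Q_{j_1,\dots,j_t}=M_{\sigma_1(j_1),\dots,\sigma_t(j_t)}$. A $t$-pattern is a $t$-dimensional $0$--$1$ matrix $P$ such that any two entries equal to $1$ have index tuples that are either equal or differ in at least two positions. A $t$-pattern $P$ is a sunflower $t$-pattern if there exist a set $S\subseteq[t]$ (the core) and indices $(c_s)_{s\in S}$ (with $c_s$ in the index range of coordinate $s$ of $P$) such that whenever $P_{i_1,\dots,i_t}=P_{j_1,\dots,j_t}=1$ with $(i_1,\dots,i_t)\neq(j_1,\dots,j_t)$, we have $i_s=j_s=c_s$ for all $s\in S$ and $i_s\neq j_s$ for all $s\notin S$. A $t$-dimensional matrix $M$ avoids a $t$-pattern $P$ if $M$ has no submatrix $Q$ of the same dimensions as $P$ with $P_{i_1,\dots,i_t}\leq Q_{i_1,\dots,i_t}$ for all index tuples. $f_t(n,P)$ denotes the maximum number of entries equal to $1$ in a $t$-dimensional $n\times\dots\times n$ $0$--$1$ matrix avoiding $P$. *)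

(* Defs.v *)
From mathcomp Require Import all_boot.

Set Implicit Arguments.
Unset Strict Implicit.
Unset Printing Implicit Defensive.

(* Coordinates and indices are numbered from 0: coordinate [r : 'I_t] of a
   matrix of size [d] ranges over ['I_(d r)]. *)
Definition index_tuple (t : nat) (d : 'I_t -> nat) : finType :=
  {dffun forall r : 'I_t, 'I_(d r)}.

(* An entry is 1 when it is [true], and [bool] coerces to [nat]. *)
Definition matrix01 (t : nat) (d : 'I_t -> nat) : finType :=
  {ffun index_tuple d -> bool}.

Definition selection (t : nat) (m n : 'I_t -> nat) : finType :=
  {dffun forall r : 'I_t, {ffun 'I_(m r) -> 'I_(n r)}}.

Definition increasing (t : nat) (m n : 'I_t -> nat) (sigma : selection m n) :
    bool :=
  [forall r : 'I_t, forall j : 'I_(m r), forall k : 'I_(m r),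
    (j < k) ==> (sigma r j < sigma r k)].

Definition submatrix (t : nat) (m n : 'I_t -> nat) (M : matrix01 n)
    (sigma : selection m n) : matrix01 m :=
  [ffun j : index_tuple m =>
    M [ffun r : 'I_t => sigma r (j r)]].

Definition is_pattern (t : nat) (d : 'I_t -> nat) (P : matrix01 d) : Prop :=
  forall i j : index_tuple d, P i = true -> P j = true ->
    i = j \/ 2 <= #|[set r : 'I_t | i r != j r]|.

Definition is_sunflower_pattern (t : nat) (d : 'I_t -> nat) (P : matrix01 d) :
    Prop :=
  is_pattern P /\
  exists (S : {set 'I_t}) (c : forall s : 'I_t, s \in S -> 'I_(d s)),
    forall i j : index_tuple d, P i = true -> P j = true -> i <> j ->
      (forall (s : 'I_t) (sS : s \in S), i s = c s sS /\ j s = c s sS) /\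
      (forall s : 'I_t, s \notin S -> i s <> j s).

Definition avoids (t : nat) (m n : 'I_t -> nat) (M : matrix01 n)
    (P : matrix01 m) : bool :=
  ~~ [exists sigma : selection m n, increasing sigma &&
       [forall i : index_tuple m, P i <= submatrix M sigma i]].

Definition weight (t : nat) (d : 'I_t -> nat) (M : matrix01 d) : nat :=
  #|[set i : index_tuple d | M i]|.

(* If no n x ... x n matrix avoids [P] (which requires [P] to have no entry
   equal to 1), this maximum over the empty set is 0. *)
Definition extremal (t n : nat) (m : 'I_t -> nat) (P : matrix01 m) : nat :=
  \max_(M : matrix01 (fun _ : 'I_t => n) | avoids M P) weight M.

(* Main.v *)
Require Import Defs.
From mathcomp Require Import all_boot zify.

(** Call a pattern an "order pattern" if only the relative order of the
    coordinates of its ones is prescribed.  The heart is the Marcus-Tardos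
    argument in arbitrary dimension, as extended by Klazar and Marcus: cut an
    array avoiding an order pattern with ranks below [K] into blocks of side
    [s].  The nonempty blocks again avoid the pattern, and a block whose ones
    have at most [K] residues in every direction contains at most [K ^ d] ones.
    If a block is wide in direction [r], colour it by the set of [r]-residues
    of its ones; the blocks of a given colour in a given layer orthogonal to
    [r] avoid the pattern in the remaining [d - 1] directions, so induction on
    [d] bounds their number.  Since [K ^ d < s ^ (d - 1)], the resulting
    recursion solves to [O(n ^ (d - 1))].

    For a sunflower, freeze the coordinates of the core.  A slice away from the
    boundary avoids the order pattern formed by the petals and by extra ones
    filling the unused layers: an occurrence gives the petal coordinates of a
    submatrix, and the core coordinates are chosen as consecutive layers around
    the slice.  The boundary slices contain [O(n ^ (t - 1))] entries. *)

Set Implicit Arguments.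
Unset Strict Implicit.
Unset Printing Implicit Defensive.

(** * Counting and choosing in finite sets *)

Lemma leq_card_fibers (X Y : finType) (f : X -> Y) (A : {set X}) (b : nat) :
    (forall y, y \in f @: A -> #|[set x in A | f x == y]| <= b) ->
  #|A| <= #|f @: A| * b.
Proof.
move=> fib; rewrite -sum1_card (partition_big_imset f) /=.
rewrite -sum_nat_const; apply: leq_sum => y /fib; apply: leq_trans.
by rewrite sum1dep_card.
Qed.

Lemma leq_card_bigcup (X J : finType) (A : pred J) (F : J -> {set X}) :
  #|\bigcup_(j | A j) F j| <= \sum_(j | A j) #|F j|.
Proof.
elim/big_rec2: _ => [|j k U _ IH]; first by rewrite cards0.
by apply: leq_trans (leq_card_setU _ _) _; rewrite leq_add2l.
Qed.

Lemma ord_set_increasing (n k : nat) (W : {set 'I_n}) : k <= #|W| ->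
  exists w : 'I_k -> 'I_n,
    (forall i, w i \in W) /\ (forall i j : 'I_k, i < j -> w i < w j).
Proof.
move=> kW; pose s := sort (fun x y : 'I_n => x <= y) (enum W).
have ss : size s = #|W| by rewrite size_sort -cardE.
have us : uniq s by rewrite sort_uniq enum_uniq.
have [n0|n0] := posnP k.
  by subst k; exists (fun i : 'I_0 => False_rect _ (notF (ltn_ord i))); split=> -[].
have [x0 _] : exists x0, x0 \in W by apply/card_gt0P; apply: leq_trans kW.
have srt : sorted (fun x y : 'I_n => x <= y) s.
  by apply: sort_sorted => x y; exact: leq_total.
exists (fun i => nth x0 s i); split=> [i|i j ij].
  rewrite -mem_enum -(mem_sort (fun x y : 'I_n => x <= y)) mem_nth // ss.
  exact: leq_trans (ltn_ord i) kW.
have si (a : 'I_k) : a < size s by rewrite ss (leq_trans (ltn_ord a) kW).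
rewrite ltn_neqAle; apply/andP; split.
  by apply/eqP => /val_inj/eqP; rewrite nth_uniq // (ltn_eqF ij).
apply: (sorted_leq_nth (leT := fun x y : 'I_n => x <= y)) => //.
- by move=> y x z; apply: leq_trans.
- by rewrite inE.
- by rewrite inE.
exact: ltnW.
Qed.

(** * Order patterns in a box *)

Section OrderPatterns.

(* [I] indexes the ones of the pattern and [pi r i] is the rank of the one [i]
   in direction [r].  Ranks may be repeated, in which case nothing is required. *)
Variables (T I : finType) (K : nat) (pi : T -> I -> 'I_K).

(** [A] then lives in a box of dimension [#|D|], the directions outside [D] being frozen. *)
Definition agree_off (n : nat) (D : {set T}) (A : {set {ffun T -> 'I_n}}) :=
  {in A &, forall (x y : {ffun T -> 'I_n}) r, r \notin D -> x r = y r}.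

(* Only the directions in [D] are compared: this lets the induction drop a
   direction without changing the ambient type. *)
Definition occurs (n : nat) (D : {set T}) (A : {set {ffun T -> 'I_n}}) :=
  exists2 e : I -> {ffun T -> 'I_n}, (forall i, e i \in A) &
    forall r, r \in D -> forall i j, pi r i < pi r j -> e i r < e j r.

Lemma leq_card_box (n c : nat) (D : {set T}) (A : {set {ffun T -> 'I_n}}) :
    agree_off D A ->
    (forall r, r \in D -> #|[set (x : {ffun T -> 'I_n}) r | x in A]| <= c) ->
  #|A| <= c ^ #|D|.
Proof.
move=> agA cW; pose W r := [set (x : {ffun T -> 'I_n}) r | x in A].
have /subset_leq_card/leq_trans -> // : A \subset family (fun r => mem (W r)).
  by apply/subsetP => x xA; apply/familyP => r; apply: imset_f.
rewrite card_family foldrE big_map big_enum /=.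
rewrite (bigID (mem D)) /= -[X in _ <= X]muln1 leq_mul //.
  rewrite -prod_nat_const; apply: leq_prod => r rD; exact: cW.
apply: (@leq_trans (\prod_(r | r \notin D) 1)); last by rewrite big1.
apply: leq_prod => r rD; apply/card_le1_eqP.
move=> u v /imsetP[x xA ->] /imsetP[y yA ->]; exact: agA.
Qed.

Lemma card_ord_below (n N : nat) : #|[set v : 'I_n | v < N]| <= N.
Proof.
rewrite -[X in _ <= X](card_ord N); case: N => [|N].
  by rewrite eq_card0 // => v; rewrite inE.
rewrite -(card_in_imset (f := fun v : 'I_n => inord v : 'I_N.+1)) ?max_card //.
move=> u v; rewrite !inE => uN vN /(congr1 val); rewrite /= !inordK //.
exact: val_inj.
Qed.

Lemma leq_card_below (n N : nat) (D : {set T}) (A : {set {ffun T -> 'I_n}}) :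
    agree_off D A -> (forall x, x \in A -> forall r, r \in D -> x r < N) ->
  #|A| <= N ^ #|D|.
Proof.
move=> agA ltA; apply: leq_card_box => // r rD.
apply: leq_trans (card_ord_below n N); apply: subset_leq_card.
by apply/subsetP => v /imsetP[x xA ->]; rewrite inE ltA.
Qed.

(** The dimension is [d.+1]. The side [N] is separate from the ambient [n], so that blocks stay in
    the type of the points. *)
Definition bounded_in (d a N : nat) :=
  forall (D : {set T}) (n : nat) (A : {set {ffun T -> 'I_n}}),
    #|D| = d.+1 -> agree_off D A ->
    (forall x, x \in A -> forall r, r \in D -> x r < N) ->
    ~ occurs D A -> #|A| <= a * N ^ d.

(** [K] distinct values on a line, listed increasingly, realize any assignment of ranks below
    [K]. *)
Lemma bounded_in_line (N : nat) : bounded_in 0 K N.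
Proof.
move=> D n A /eqP/cards1P[r ->{D}] agA _ noA; rewrite expn0 muln1 leqNgt.
apply/negP => KA; apply: noA.
have injA : {in A &, injective (fun x : {ffun T -> 'I_n} => x r)}.
  move=> x y xA yA xyr; apply/ffunP => r'; have [-> //|r'r] := eqVneq r' r.
  by apply: agA => //; rewrite inE.
have := ltnW KA; rewrite -(card_in_imset injA).
case/ord_set_increasing => w [wA incw].
have /fin_all_exists2[e eA ew] i : exists2 x, x \in A & x r = w (pi r i).
  by have /imsetP[x xA ->] := wA (pi r i); exists x.
exists e => // r'; rewrite inE => /eqP -> i j ij.
by rewrite !ew; apply: incw.
Qed.

(** * Contraction to blocks *)

Definition block_ord (n s : nat) (v : 'I_n) : 'I_n :=
  Ordinal (leq_ltn_trans (leq_div v s) (ltn_ord v)).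

Definition block (n s : nat) (x : {ffun T -> 'I_n}) : {ffun T -> 'I_n} :=
  [ffun r => block_ord s (x r)].

Lemma blockE (n s : nat) (x : {ffun T -> 'I_n}) r :
  block s x r = x r %/ s :> nat.
Proof. by rewrite ffunE. Qed.

Definition residues (n s : nat) (A : {set {ffun T -> 'I_n}})
    (y : {ffun T -> 'I_n}) (r : T) : {set 'I_s.+1} :=
  [set inord (x r %% s.+1) | x : {ffun T -> 'I_n} in A & block s.+1 x == y].

Lemma block_mod_inj (n s : nat) (x y : {ffun T -> 'I_n}) r :
  block s.+1 x r = block s.+1 y r ->
  inord (x r %% s.+1) = inord (y r %% s.+1) :> 'I_s.+1 -> x r = y r.
Proof.
move=> /(congr1 val) /=; rewrite !blockE => qE /(congr1 val).
rewrite /= !inordK ?ltn_mod // => mE; apply: val_inj.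
by rewrite /= (divn_eq (x r) s.+1) qE mE -divn_eq.
Qed.

(** Within one block a residue determines the coordinate, so projections inject into residue
    sets. *)
Lemma leq_card_block (n s c : nat) (D : {set T}) (A : {set {ffun T -> 'I_n}})
    (y : {ffun T -> 'I_n}) :
    agree_off D A -> (forall r, r \in D -> #|residues s A y r| <= c) ->
  #|[set x in A | block s.+1 x == y]| <= c ^ #|D|.
Proof.
move=> agA cR; set F := [set x in A | _].
have FP x : x \in F -> x \in A /\ block s.+1 x = y.
  by rewrite inE => /andP[xA /eqP].
apply: leq_card_box => [x x' /FP[xA _] /FP[xA' _]|r rD]; first exact: agA.
apply: leq_trans (cR r rD); set V := [set _ | _ in _].
rewrite -(card_in_imset (D := mem V)
  (f := fun v : 'I_n => inord (v %% s.+1) : 'I_s.+1)).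
  apply/subset_leq_card/subsetP => u /imsetP[v /imsetP[z /FP[zA zy] ->] ->].
  by apply: imset_f; rewrite inE zA zy eqxx.
move=> u v /imsetP[z /FP[_ zy] ->] /imsetP[z' /FP[_ zy'] ->].
by apply: block_mod_inj; rewrite zy zy'.
Qed.

Lemma occurs_blocks (n s : nat) (D : {set T}) (A : {set {ffun T -> 'I_n}}) :
  occurs D (block s @: A) -> occurs D A.
Proof.
case=> e eA incE.
have /fin_all_exists2[f fA fe] i : exists2 x, x \in A & e i = block s x.
  by have /imsetP[x xA ->] := eA i; exists x.
exists f => // r rD i j ij; have := incE r rD i j ij.
by rewrite !fe !blockE => lt_q; rewrite ltnNge; apply/negP => /(leq_div2r s); lia.
Qed.

(** In direction [r] the blocks share one layer and one residue set, so the representative for [i]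
    can be given the residue numbered [pi r i]; in the other directions the blocks already fix the
    order. *)
Lemma occurs_wide_blocks (n s : nat) (D : {set T}) (A C : {set {ffun T -> 'I_n}})
    (r : T) (v : 'I_n) (W : {set 'I_s.+1}) :
    K <= #|W| ->
    (forall y, y \in C -> y r = v /\ residues s A y r = W) ->
  occurs (D :\ r) C -> occurs D A.
Proof.
move=> KW CP [e eC incE]; have [w [wW incw]] := ord_set_increasing KW.
have /fin_all_exists2[f fA /all_and2[fe fw]] i : exists2 x, x \in A &
    block s.+1 x = e i /\ x r %% s.+1 = w (pi r i).
  have [_ resE] := CP _ (eC i); have := wW (pi r i).
  rewrite -{1}resE => /imsetP[x]; rewrite inE => /andP[xA /eqP xe] ->.
  by exists x => //; rewrite inordK ?ltn_mod.
exists f => // r' r'D i j ij; have [r'E|r'r] := eqVneq r' r.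
  subst r'; rewrite (divn_eq (f i r) s.+1) (divn_eq (f j r) s.+1) !fw.
  rewrite -!blockE !fe (CP _ (eC i)).1 (CP _ (eC j)).1 ltn_add2l; exact: incw.
have := incE r' _ i j ij; rewrite !inE r'r r'D => /(_ isT).
by rewrite -!fe !blockE => lt_q; rewrite ltnNge; apply/negP => /(leq_div2r s.+1); lia.
Qed.

(** * The recursion on the side length *)

Lemma leq_card_wide_blocks (d a N n s : nat) (D : {set T}) (r : T)
    (A : {set {ffun T -> 'I_n}}) :
    bounded_in d a N -> #|D| = d.+2 -> r \in D -> agree_off D A ->
    (forall x, x \in A -> forall r, r \in D -> x r < N * s.+1) ->
    ~ occurs D A ->
  #|[set y in block s.+1 @: A | K <= #|residues s A y r|]| <=
    N * 2 ^ s.+1 * (a * N ^ d).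
Proof.
move=> bnd cD rD agA ltA noA; set B := [set y in _ | _].
have Blt y r' : y \in B -> r' \in D -> y r' < N.
  rewrite inE => /andP[/imsetP[x xA ->] _] r'D.
  by rewrite blockE ltn_divLR // ltA.
(* Pigeonhole on layer and colour: each fibre of [f] is handled in one dimension less. *)
pose f (y : {ffun T -> 'I_n}) := (y r, residues s A y r).
have fB : #|f @: B| <= N * 2 ^ s.+1.
  have sub : f @: B \subset setX [set v : 'I_n | v < N] (powerset [set: 'I_s.+1]).
    apply/subsetP => z /imsetP[y yB ->].
    by rewrite in_setX inE Blt // powersetE subsetT.
  apply: leq_trans (subset_leq_card sub) _.
  by rewrite cardsX card_powerset cardsT card_ord leq_mul2r card_ord_below orbT.
apply: leq_trans (leq_mul fB (leqnn _)).
apply: leq_card_fibers => -[v W] /imsetP[y0 y0B [vE WE]].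
apply: (bnd (D :\ r)) => //.
- by move: (cardsD1 r D); rewrite rD cD => -[].
- move=> y z; rewrite !inE => /andP[yB /eqP[yv _]] /andP[zB /eqP[zv _]] r'.
  rewrite !inE negb_and negbK => /orP[/eqP ->|r'D]; first by rewrite yv zv.
  case/andP: yB => /imsetP[x xA ->] _; case/andP: zB => /imsetP[x' xA' ->] _.
  by apply: val_inj; rewrite /= !blockE (agA x x').
- move=> y; rewrite inE => /andP[yB _] r'; rewrite !inE => /andP[_ r'D].
  exact: Blt.
apply: contra_not noA; apply: (occurs_wide_blocks (v := v) (W := W)).
  by rewrite WE; move: y0B; rewrite inE => /andP[].
by move=> y; rewrite !inE => /andP[_ /eqP[-> ->]].
Qed.

Lemma bounded_in_pow (d a : nat) : (forall N, bounded_in d a N) ->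
  exists a' s, 1 < s /\ forall k, bounded_in d.+1 a' (s ^ k).
Proof.
(* In [c], [d.+2] counts directions, [2 ^ s.+1 * a] the wide blocks per direction in units of
   [N ^ d.+1], and [s.+1 ^ d.+2] the points of a block. *)
move=> bnd; pose s := (K ^ d.+2).+1; pose c := d.+2 * (2 ^ s.+1 * a * s.+1 ^ d.+2).
exists c.+1, s.+1; split=> //.
elim=> [|k IHk] D n A cD agA ltA noA.
  by apply: leq_trans (leq_card_below agA ltA) _; rewrite expn0 !exp1n muln1.
set N := s.+1 ^ k in IHk; set B := block s.+1 @: A.
have ltA' x : x \in A -> forall r, r \in D -> x r < N * s.+1.
  by move=> xA r rD; rewrite -expnSr ltA.
have agB : agree_off D B.
  move=> y z /imsetP[x xA ->] /imsetP[x' xA' ->] r rD.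
  by apply: val_inj; rewrite /= !blockE (agA x x').
have cB : #|B| <= c.+1 * N ^ d.+1.
  apply: (IHk D) => //.
    by move=> y /imsetP[x xA ->] r rD; rewrite blockE ltn_divLR // ltA'.
  by apply: contra_not noA; apply: occurs_blocks.
pose thin := [set x in A | [forall r in D, #|residues s A (block s.+1 x) r| <= K]].
pose wide r := [set x in A | K <= #|residues s A (block s.+1 x) r|].
have cthin : #|thin| <= c.+1 * N ^ d.+1 * K ^ d.+2.
  apply: (@leq_trans (#|block s.+1 @: thin| * K ^ d.+2)); last first.
    rewrite leq_mul2r; apply/orP; right; apply: leq_trans cB.
    by apply/subset_leq_card/imsetS/subsetP => x; rewrite inE => /andP[].
  apply: leq_card_fibers => _ /imsetP[x xthin ->].
  apply: (@leq_trans #|[set z in A | block s.+1 z == block s.+1 x]|).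
    by apply/subset_leq_card/subsetP => z; rewrite !inE => /andP[/andP[-> _] ->].
  rewrite -cD; apply: leq_card_block => // r rD.
  by move: xthin; rewrite inE => /andP[_ /forall_inP]; apply.
have cwide r : r \in D -> #|wide r| <= N * 2 ^ s.+1 * (a * N ^ d) * s.+1 ^ d.+2.
  move=> rD.
  have cw := leq_card_wide_blocks (bnd N) cD rD agA ltA' noA.
  apply: leq_trans (leq_mul cw (leqnn _)).
  apply: (@leq_trans (#|block s.+1 @: wide r| * s.+1 ^ d.+2)).
    apply: leq_card_fibers => y _.
    apply: (@leq_trans #|[set z in A | block s.+1 z == y]|).
      by apply/subset_leq_card/subsetP => z; rewrite !inE => /andP[/andP[-> _] ->].
    rewrite -cD; apply: leq_card_block => // r' _.
    by rewrite -[X in _ <= X]card_ord max_card.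
  rewrite leq_mul2r; apply/orP; right; apply/subset_leq_card/subsetP => y.
  case/imsetP=> x xw ->; move: xw; rewrite !inE => /andP[xA ->].
  by rewrite andbT imset_f.
have sub : A \subset thin :|: \bigcup_(r in D) wide r.
  apply/subsetP => x xA; rewrite !inE xA /=.
  case: (boolP [forall r in D, _]) => //= /forall_inPn[r rD]; rewrite -ltnNge => Kr.
  by apply/bigcupP; exists r; rewrite // inE xA ltnW.
apply: leq_trans (subset_leq_card sub) _.
apply: leq_trans (leq_card_setU _ _) _.
have cS : \sum_(r in D) #|wide r| <= c * N ^ d.+1.
  apply: (@leq_trans (#|D| * (N * 2 ^ s.+1 * (a * N ^ d) * s.+1 ^ d.+2))).
    by rewrite -sum_nat_const; apply: leq_sum.
  rewrite cD /c [N ^ d.+1]expnS.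
  lia.
apply: leq_trans (leq_add cthin (leq_trans (leq_card_bigcup _ _) cS)) _.
have -> : (s.+1 ^ k.+1) ^ d.+1 = N ^ d.+1 * s.+1 ^ d.+1.
  by rewrite [s.+1 ^ k.+1]expnSr expnMn.
have : s.+1 <= s.+1 ^ d.+1 by rewrite -{1}(expn1 s.+1) leq_pexp2l.
rewrite {1}/s; set M := N ^ d.+1; set Q := s.+1 ^ d.+1; set k' := K ^ d.+2.
(* [k'.+2] is the block side: the thin part uses [k'] of it, and the wide part at most one more. *)
move=> h; apply: (@leq_trans (c.+1 * M * k'.+2)); first by nia.
by rewrite mulnA leq_mul2l h orbT.
Qed.

Theorem bounded_in_linear (d : nat) :
  exists a, forall N, bounded_in d a N.
Proof.
elim: d => [|d [a bnd]]; first by exists K; apply: bounded_in_line.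
have [a' [s [s1 bnd']]] := bounded_in_pow bnd.
(* Rounding [N] up to a power of [s] enlarges the side by a factor of at most [s]. *)
exists (a' * s ^ d.+1) => N D n A cD agA ltA noA.
have [N0|N0] := posnP N.
  have [-> |[x xA]] := set_0Vmem A; first by rewrite cards0.
  have [r rD] : exists r, r \in D by apply/card_gt0P; rewrite cD.
  by have := ltA x xA r rD; rewrite N0.
have /andP[lo hi] := trunc_log_bounds s1 N0.
apply: leq_trans (bnd' (trunc_log s N).+1 D n A cD agA _ noA) _.
  by move=> x xA r rD; apply: ltn_trans (ltA x xA r rD) hi.
by rewrite [s ^ (trunc_log s N).+1]expnS expnMn mulnA leq_mul2l leq_exp2r // lo orbT.
Qed.

End OrderPatterns.

(** * Slices and boundary layers *)

Lemma leq_card_slices (T : finType) (n b : nat) (D : {set T})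
    (A : {set {ffun T -> 'I_n.+1}}) :
    (forall z, z \in A ->
       #|[set x in A | [forall r in ~: D, x r == z r]]| <= b) ->
  #|A| <= n.+1 ^ #|~: D| * b.
Proof.
move=> slA.
(* Overwriting the directions in [D] by [ord0] leaves exactly the coordinates that identify a
   slice. *)
pose f (x : {ffun T -> 'I_n.+1}) := [ffun r => if r \in D then ord0 else x r].
have fA : #|f @: A| <= n.+1 ^ #|~: D|.
  apply: leq_card_below => [y z /imsetP[x _ ->] /imsetP[x' _ ->] r|y _ r _].
    by rewrite inE negbK !ffunE => ->.
  exact: ltn_ord.
apply: leq_trans (leq_mul fA (leqnn b)); apply: leq_card_fibers.
move=> _ /imsetP[z zA ->]; apply: leq_trans (slA z zA).
apply/subset_leq_card/subsetP => x; rewrite !inE => /andP[-> /eqP/ffunP fE].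
apply/forall_inP => r; rewrite inE => rD.
by have := fE r; rewrite !ffunE (negPf rD) => ->.
Qed.

Lemma leq_card_boundary (T : finType) (n k : nat) (r : T) :
  #|[set x : {ffun T -> 'I_n} | (x r < k) || (n < x r + k)]| <=
    (k + k) * n ^ #|T|.-1.
Proof.
set X := [set x | _]; pose f (x : {ffun T -> 'I_n}) := x r.
have fX : #|f @: X| <= k + k.
  have sub : f @: X \subset [set v : 'I_n | v < k] :|:
      (@rev_ord n) @: [set v : 'I_n | v < k].
    apply/subsetP => v /imsetP[x xX ->]; move: xX; rewrite !inE => xr.
    case/orP: xr => [-> //|xr]; apply/orP; right.
    rewrite -[f x]rev_ordK imset_f // inE /=.
    by have := ltn_ord (f x); rewrite /f; lia.
  apply: leq_trans (subset_leq_card sub) _.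
  apply: leq_trans (leq_card_setU _ _) _.
  by rewrite card_imset; [rewrite leq_add // card_ord_below | exact: rev_ord_inj].
apply: leq_trans (leq_mul fX (leqnn _)); apply: leq_card_fibers => v _.
rewrite -(cardsC1 r); apply: leq_card_below => [x y|x _ r' _].
  rewrite !inE => /andP[_ /eqP xv] /andP[_ /eqP yv] r'.
  by rewrite !inE negbK => /eqP ->; rewrite -/(f x) -/(f y) xv yv.
exact: ltn_ord.
Qed.

(** * From order patterns to sunflowers *)

Section Sunflower.

Variables (t : nat) (m : 'I_t -> nat) (P : matrix01 m).
(** [D] collects the petal directions, its complement is the core. *)
Variables (D : {set 'I_t}) (c : 'I_t -> nat).
Hypothesis c_lt : forall r, r \notin D -> c r < m r.
Hypothesis P_core :
  forall o, P o -> forall r, r \notin D -> o r = c r :> nat.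
Hypothesis P_petals :
  forall o o', P o -> P o' -> forall r, r \in D -> o r = o' r -> o = o'.

(** One bound for all dimensions of [P], serving as rank bound, number of fillers and boundary
    margin. *)
Let K := \sum_r m r.

Lemma leq_dim_sum r : m r <= K.
Proof. by rewrite /K (bigD1 r) //= leq_addr. Qed.

(* The indices [inr j] are fillers, placed on the diagonal, which supply a layer
   for every index not used by a one of [P]. *)
Definition petal_rank (r : 'I_t) (i : index_tuple m + 'I_K) : 'I_K :=
  match i with
  | inl o => widen_ord (leq_dim_sum r) (o r)
  | inr j => j
  end.

(** A section of [petal_rank r] that prefers ones of [P], so that a one is sent to its own image in
    every petal direction. *)
Definition petal_at (r : 'I_t) (j : 'I_(m r)) : index_tuple m + 'I_K :=
  if [pick o | P o && (o r == j)] is Some o then inl o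
  else inr (widen_ord (leq_dim_sum r) j).

Lemma petal_rank_at r (j : 'I_(m r)) : petal_rank r (petal_at j) = j :> nat.
Proof. by rewrite /petal_at; case: pickP => [o /andP[_ /eqP <-]|]. Qed.

Lemma petal_at_one r o : r \in D -> P o -> petal_at (o r) = inl o.
Proof.
move=> rD Po; rewrite /petal_at; case: pickP => [o' /andP[Po' /eqP o'r]|/(_ o)].
  by rewrite (P_petals Po' Po rD o'r).
by rewrite Po eqxx.
Qed.

Lemma occurs_slice_contains (n : nat) (M : matrix01 (fun _ : 'I_t => n.+1))
    (A : {set {ffun 'I_t -> 'I_n.+1}}) (z : {ffun 'I_t -> 'I_n.+1}) :
    (forall x, x \in A -> M x) ->
    (forall x r, x \in A -> r \notin D -> x r = z r) ->
    (forall r, r \notin D -> K <= z r /\ z r + K <= n.+1) ->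
  occurs petal_rank D A -> ~~ avoids M P.
Proof.
move=> AM Az zK [e eA incE]; rewrite negbK; apply/existsP.
(* In a core direction the index [c r] lands on the layer [z r]; the margin [K] keeps the
   neighbouring layers in range. *)
pose sigma : selection m (fun _ : 'I_t => n.+1) :=
  [ffun r => [ffun j : 'I_(m r) =>
    if r \in D then e (petal_at j) r else inord (z r - c r + j)]].
have sigmaE r (j : 'I_(m r)) : sigma r j =
    if r \in D then e (petal_at j) r else inord (z r - c r + j).
  by rewrite /sigma !ffunE.
exists sigma; apply/andP; split.
  apply/forallP => r; apply/forallP => j; apply/forallP => k; apply/implyP => jk.
  rewrite !sigmaE; case: (boolP (r \in D)) => rD.
    by apply: incE => //; rewrite !petal_rank_at.
  have [zlo zhi] := zK r rD; have mK := leq_dim_sum r.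
  have jm := ltn_ord j; have km := ltn_ord k; rewrite !inordK; lia.
apply/forallP => o; rewrite ffunE; case: (boolP (P o)) => // Po.
set x := (X in M X); suff -> : x = e (inl o) by rewrite AM.
apply/ffunP => r; rewrite ffunE sigmaE; case: (boolP (r \in D)) => rD.
  by rewrite petal_at_one.
rewrite (P_core Po rD) (Az _ _ (eA _) rD) subnK ?inord_val //.
have [zlo _] := zK r rD; have := c_lt rD; have := leq_dim_sum r; lia.
Qed.

Lemma extremal_bound : 0 < #|D| ->
  exists a, forall n, 0 < n -> extremal n P <= a * n ^ (t - 1).
Proof.
move=> D0; have [a bnd] := bounded_in_linear petal_rank #|D|.-1.
exists (a + t * (K + K)) => -[//|n] _; apply/bigmax_leqP => M avM.
pose X := [set x : {ffun 'I_t -> 'I_n.+1} | M x].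
have -> : weight M = #|X|.
  pose toI (x : {ffun 'I_t -> 'I_n.+1}) : index_tuple (fun _ : 'I_t => n.+1) := x.
  rewrite -(@card_imset _ _ toI X) => [|x y //].
  congr #|pred_of_set _|; apply/setP => x; rewrite inE; apply/idP/imsetP => [xM|[y]].
    by exists x; rewrite ?inE.
  by rewrite inE => yM ->.
pose bad r := [set x : {ffun 'I_t -> 'I_n.+1} | (x r < K) || (n.+1 < x r + K)].
pose good := [set x in X | [forall r in ~: D, x \notin bad r]].
have sub : X \subset good :|: \bigcup_(r : 'I_t) bad r.
  apply/subsetP => x xX; rewrite in_setU [x \in good]inE xX /=.
  case: (boolP [forall r in ~: D, _]) => //= /forall_inPn[r _].
  by rewrite negbK => xr; apply/bigcupP; exists r.
apply: leq_trans (subset_leq_card sub) _.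
apply: leq_trans (leq_card_setU _ _) _; rewrite mulnDl leq_add //; last first.
  apply: leq_trans (leq_card_bigcup _ _) _.
  apply: (@leq_trans (\sum_(r : 'I_t) (K + K) * n.+1 ^ (t - 1))); last first.
    by rewrite sum_nat_const card_ord mulnA.
  by apply: leq_sum => r _; have := leq_card_boundary n.+1 K r; rewrite card_ord subn1.
(* The first exponent counts slices, the second comes from the bound within a slice. *)
have -> : t - 1 = #|~: D| + #|D|.-1.
  by have := cardsC D; rewrite card_ord; lia.
rewrite expnD mulnCA; apply: leq_card_slices => z.
rewrite inE => /andP[_ /forall_inP zgood]; set A := [set x in good | _].
have Az x r : x \in A -> r \notin D -> x r = z r.
  by rewrite inE => /andP[_ /forall_inP H] rD; apply/eqP/H; rewrite inE.
apply: (bnd n.+1 D) => //.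
- by rewrite prednK.
- by move=> x y xA yA r rD; rewrite !Az.
move=> occA; suff : ~~ avoids M P by rewrite avM.
apply: (occurs_slice_contains (z := z) _ _ _ occA) => // [x|r rD].
  by rewrite !inE => /andP[/andP[]].
have := zgood r; rewrite !inE => /(_ rD); lia.
Qed.

End Sunflower.

Theorem theorem1 (t : nat) (ht : 2 <= t) (m : 'I_t -> nat) (P : matrix01 m)
    (hP : is_sunflower_pattern P) :
  exists a : nat, forall n : nat, 0 < n -> extremal n P <= a * n ^ (t - 1).
Proof.
case: hP => patP [S [c sunP]].
have [/existsP[o /existsP[o' /and3P[Po Po' oo']]]|] :=
    boolP [exists o, exists o', [&& P o, P o' & o != o']].
  (* All ones agree with [o] on the core, so [o] supplies the core indices. As [o] and [o'] differ
     somewhere, and only off [S], [~: S] is nonempty. *)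
  apply: (@extremal_bound t m P (~: S) (fun r => o r)).
  - by move=> r _; apply: ltn_ord.
  - move=> o1 Po1 r; rewrite inE negbK => rS; congr val.
    have [-> //|/eqP o1o] := eqVneq o1 o.
    by have [/(_ r rS)[-> ->]] := sunP _ _ Po1 Po o1o.
  - move=> o1 o2 Po1 Po2 r; rewrite inE => rS o12.
    have [//|/eqP ne12] := eqVneq o1 o2.
    by have [_ /(_ r rS)] := sunP _ _ Po1 Po2 ne12.
  have [/eqP|] := patP _ _ Po Po'; first by rewrite (negPf oo').
  move=> /ltnW/leq_trans; apply; apply/subset_leq_card/subsetP => r.
  rewrite !inE; apply: contraNN => rS.
  by have [/(_ r rS)[-> ->]] := sunP _ _ Po Po' (elimN eqP oo').
(* With at most one entry equal to 1, every direction can serve as a petal direction. *)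
move=> /existsPn noP; apply: (@extremal_bound t m P setT (fun _ => 0)).
- by move=> r; rewrite inE.
- by move=> o _ r; rewrite inE.
- move=> o o' Po Po' _ _ _; apply/eqP; have /existsPn/(_ o') := noP o.
  by rewrite Po Po' negbK.
by rewrite cardsT card_ord ltnW.
Qed.
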